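(* The square grid $\mathbb{Z}^2$ admits a harmonic labeling, i.e. there is a bijection $\phi:\mathbb{Z}^2\to\mathbb{Z}$ such that for every $(x,y)\in\mathbb{Z}^2$, $\phi(x,y)=\frac14\big(\phi(x+1,y)+\phi(x-1,y)+\phi(x,y+1)+\phi(x,y-1)\big)$.
   Context: $\mathbb{Z}^2$ is the graph with vertex set $\mathbb{Z}^2$ where two points are adjacent iff they differ by $1$ in exactly one coordinate. A harmonic labeling of a graph is a bijection $\phi:V\to\mathbb{Z}$ with $\phi(x)=\frac{1}{\deg(x)}\sum_{y\sim x}\phi(y)$ for every vertex $x$. *)

(* Defs.v *)
From HB Require Import structures.
From mathcomp Require Import all_boot all_order all_algebra.
From mathcomp Require Import zify.

Set Implicit Arguments.
Unset Strict Implicit.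
Unset Printing Implicit Defensive.

Import Order.TTheory GRing.Theory Num.Theory.

Local Open Scope ring_scope.

(* The list [nbrs x] is determined up to permutation by [adj]; it makes the
   finite sums over neighborhoods available. *)
Record lf_graph := LfGraph {
  vertex :> eqType;
  adj : rel vertex;
  nbrs : vertex -> seq vertex;
  adj_sym : symmetric adj;
  adj_irrefl : irreflexive adj;
  nbrs_uniq : forall x, uniq (nbrs x);
  mem_nbrs : forall x y, (y \in nbrs x) = adj x y
}.

Definition deg (G : lf_graph) (x : G) : nat := size (nbrs x).

(* Labels are embedded in rat, so that the division is a true one. *)
Definition harmonic_labeling (G : lf_graph) (phi : G -> int) : Prop :=
  bijective phi /\
  forall x : G,
    (phi x)%:~R = (deg x)%:R^-1 * \sum_(y <- nbrs x) (phi y)%:~R :> rat.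

Arguments harmonic_labeling : clear implicits.

Definition grid_adj : rel (int * int) := fun u v =>
  ((`|u.1 - v.1| == 1) && (u.2 == v.2)) || ((u.1 == v.1) && (`|u.2 - v.2| == 1)).

Definition grid_nbrs (u : int * int) : seq (int * int) :=
  [:: (u.1 + 1, u.2); (u.1 - 1, u.2); (u.1, u.2 + 1); (u.1, u.2 - 1)].

Lemma grid_adj_sym : symmetric grid_adj.
Proof. by move=> [a b] [c d]; rewrite /grid_adj /=; lia. Qed.

Lemma grid_adj_irrefl : irreflexive grid_adj.
Proof. by move=> [a b]; rewrite /grid_adj /=; lia. Qed.

Lemma grid_nbrs_uniq (u : int * int) : uniq (grid_nbrs u).
Proof. by case: u => a b; rewrite /grid_nbrs /= !inE !xpair_eqE; lia. Qed.

Lemma mem_grid_nbrs (u v : int * int) : (v \in grid_nbrs u) = grid_adj u v.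
Proof.
by case: u v => [a b] [c d]; rewrite /grid_nbrs /grid_adj !inE !xpair_eqE /=; lia.
Qed.

Definition square_grid : lf_graph :=
  LfGraph grid_adj_sym grid_adj_irrefl grid_nbrs_uniq mem_grid_nbrs.

(* Main.v *)
(* In the coordinates u = x + y, v = x - y the four neighbours of a point are its
   diagonal neighbours, so given a harmonic function on a rectangle [a,b] x [c,d],
   adjoining a side leaves exactly one free integer.  There is an
   integer harmonic function g vanishing for u <= b and equal, up to an
   alternating sign, to 1, -4x, 8x(x-1) on the layers u = b+1, b+2, b+3 (with x
   counted from any chosen origin).  Call f good on the rectangle if it is
   injective there and if, on each of the four adjacent outer layers, it separates
   points whose positions agree mod 4.  To extend f to the layers b+1 and b+2 and
   to attain a missing value t, first prescribe f = t at a point of layer b+2 (a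
   shifted g makes this possible without touching u <= b), take the origin of g
   there, and add B g with B large: any two relevant points are separated either by g
   or already by f, so f + B g is good on the larger rectangle.  Rotating by a
   quarter turn four times enlarges the rectangle on all sides, and the limit
   along an enumeration of the integers t is a harmonic bijection. *)
Require Import Defs.
From mathcomp Require Import all_boot all_order all_algebra.
From mathcomp Require Import zify ring.
From Stdlib Require Import ClassicalEpsilon.
Import Order.TTheory GRing.Theory Num.Theory.
Local Open Scope ring_scope.

Set Implicit Arguments.
Unset Strict Implicit.
Unset Printing Implicit Defensive.

(** * Harmonic functions on the grid *)

Definition harmonic (f : int -> int -> int) : Prop :=
  forall x y, 4 * f x y = f (x + 1) y + f (x - 1) y + f x (y + 1) + f x (y - 1).

Lemma harmonic_comb (f g : int -> int -> int) (k p q : int) :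
  harmonic f -> harmonic g -> harmonic (fun x y => f x y + k * g (x - p) (y - q)).
Proof.
move=> hf hg x y; have := hf x y; have := hg (x - p) (y - q).
rewrite !(addrAC _ (- p)) !(addrAC _ (- q)) => Eg Ef.
have -> : 4 * (f x y + k * g (x - p) (y - q))
          = 4 * f x y + k * (4 * g (x - p) (y - q)) by ring.
by rewrite Ef Eg; ring.
Qed.

Lemma harmonic_rot (f : int -> int -> int) :
  harmonic f -> harmonic (fun x y => f y (- x)).
Proof.
move=> hf x y; rewrite (hf y (- x)).
have -> : - x + 1 = - (x - 1) by ring.
have -> : - x - 1 = - (x + 1) by ring.
by ring.
Qed.

(** * A harmonic function vanishing on a half-plane *)

Definition antidiff (f : int -> int) (x : int) : int :=
  match x with
  | Posz n => - \sum_(k < n) f k%:Z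
  | Negz n => \sum_(k < n.+1) f (Negz k)
  end.

Lemma antidiffE (f : int -> int) (x : int) :
  antidiff f x - antidiff f (x + 1) = f x.
Proof.
case: x => [n|[|n]].
- have -> : n%:Z + 1 = n.+1%:Z by lia.
  by rewrite /= big_ord_recr /=; ring.
- have -> : Negz 0 + 1 = 0%:Z by [].
  by rewrite /= big_ord_recr !big_ord0 /=; ring.
- have -> : Negz n.+1 + 1 = Negz n by lia.
  by rewrite /= [in X in X - _]big_ord_recr /=; ring.
Qed.

Definition parity_sign (x : int) : int := if (2 %| x)%Z then 1 else -1.

Lemma parity_signP (x : int) :
  (2 %| x)%Z /\ parity_sign x = 1 \/ ~~ (2 %| x)%Z /\ parity_sign x = -1.
Proof. by rewrite /parity_sign; case: (2 %| x)%Z; [left|right]. Qed.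

Lemma parity_signD1 (x : int) : parity_sign (x + 1) = - parity_sign x.
Proof. by case: (parity_signP x) (parity_signP (x + 1)); lia. Qed.

(** [L] holds two consecutive layers. With the sign (-1)^x split off, harmonicity fixes the
    difference of the next layer at [x] and [x + 1], hence that layer up to a constant. *)
Definition next_layer (L : (int -> int) * (int -> int)) :
    (int -> int) * (int -> int) :=
  (L.2, antidiff (fun x => 4 * L.2 x - L.1 x + L.1 (x - 1))).

(* The layer x + y = n of the function g, up to the sign (-1)^x; layers 2 and 3 seed
   the recursion so that they are available in closed form. *)
Definition layer (n x : int) : int :=
  match n with
  | Posz 0 => 0
  | Posz 1 => 1
  | Posz n.+2 =>
      (iter n next_layer (fun x => - 4 * x, fun x => 8 * x * (x - 1))).1 x
  | Negz _ => 0
  end.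

Lemma layerE (n x : int) :
  layer (n + 1) x - layer (n + 1) (x + 1)
  = 4 * layer n x - layer (n - 1) x + layer (n - 1) (x - 1).
Proof.
case: n => [[|[|[|n]]]|[|n]]; try by rewrite /=; ring.
have -> : n.+3%:Z + 1 = n.+4%:Z by lia.
have -> : n.+3%:Z - 1 = n.+2%:Z by lia.
by rewrite /= antidiffE.
Qed.

Lemma half_plane_harmonic : exists g : int -> int -> int,
  [/\ harmonic g,
      forall x y, x + y <= 0 -> g x y = 0,
      forall x y, x + y = 1 -> g x y = parity_sign x,
      forall x y, x + y = 2 -> g x y = parity_sign x * (- 4 * x)
    & forall x y, x + y = 3 -> g x y = parity_sign x * (8 * x * (x - 1))].
Proof.
exists (fun x y => parity_sign x * layer (x + y) x); split; first last.
- by move=> x y ->.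
- by move=> x y ->.
- by move=> x y -> /=; rewrite mulr1.
- move=> x y; case: (x + y) => [[|n]|n] //=; rewrite ?mulr0 //.
- move=> x y; have := layerE (x + y) x.
  have := parity_signD1 (x - 1); rewrite subrK parity_signD1 => ->.
  have -> : x + 1 + y = x + y + 1 by ring.
  have -> : x - 1 + y = x + y - 1 by ring.
  have -> : x + (y + 1) = x + y + 1 by ring.
  have -> : x + (y - 1) = x + y - 1 by ring.
  move=> E; set s := parity_sign (x - 1).
  have -> : 4 * (- s * layer (x + y) x) = - s * (4 * layer (x + y) x) by ring.
  have -> : 4 * layer (x + y) x = layer (x + y + 1) x - layer (x + y + 1) (x + 1)
     + layer (x + y - 1) x - layer (x + y - 1) (x - 1) by rewrite E; ring.
  by ring.
Qed.

(** * Extending a good function by two layers *)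

Lemma bounded_on_square (f : int -> int -> int) (N : nat) :
  exists M : int, forall x y, `|x| <= N%:Z -> `|y| <= N%:Z -> `|f x y| <= M.
Proof.
have bnd1 (h : int -> int) : exists M : int, forall x, `|x| <= N%:Z -> `|h x| <= M.
  elim: N => [|n [M hM]].
    by exists `|h 0| => x hx; have -> : x = 0 by lia.
  exists (M + `|h n.+1%:Z| + `|h (- n.+1%:Z)|) => x hx.
  have M0 : 0 <= M by apply: le_trans (hM 0 _).
  have [->|[->|hx']] : x = n.+1%:Z \/ x = - n.+1%:Z \/ `|x| <= n%:Z by lia.
  - by lia.
  - by lia.
  - by have := hM x hx'; lia.
elim: {1}N => [|n [M hM]].
  have [M hM] := bnd1 (f 0); exists M => x y hx hy.
  have -> : x = 0 by lia.
  exact: hM.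
have [M1 h1] := bnd1 (f n.+1%:Z); have [M2 h2] := bnd1 (f (- n.+1%:Z)).
exists (M + M1 + M2) => x y hx hy.
have := hM 0 y; have := h1 y hy; have := h2 y hy.
have [->|[->|hx']] : x = n.+1%:Z \/ x = - n.+1%:Z \/ `|x| <= n%:Z by lia.
- by lia.
- by lia.
- by have := hM x y hx' hy; lia.
Qed.

Definition in_box (a b c d x y : int) : bool :=
  [&& a <= x + y, x + y <= b, c <= x - y & x - y <= d].

(** These are the sides with [x + y] constant; negating [y] exchanges x + y and x - y and yields the
    other two. *)
Definition on_layer (a b c d x y x' y' : int) : bool :=
  [&& x + y == x' + y', (x + y == a - 1) || (x + y == b + 1),
      c <= x - y <= d & c <= x' - y' <= d].

(* On a diagonal, congruence of the positions mod 4 amounts to 2 %| x - x'. *)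
Definition critical (a b c d x y x' y' : int) : bool :=
  (in_box a b c d x y && in_box a b c d x' y') ||
  ((2 %| x - x')%Z && (on_layer a b c d x y x' y' ||
                       on_layer c d a b x (- y) x' (- y'))).

Definition good (f : int -> int -> int) (a b c d : int) : Prop :=
  forall x y x' y', critical a b c d x y x' y' ->
    (x != x') || (y != y') -> f x y != f x' y'.

Lemma good_rot (f : int -> int -> int) (a b c d : int) :
  good f a b c d -> good (fun x y => f y (- x)) c d (- b) (- a).
Proof.
move=> gf x y x' y' hc hne; apply: gf; last by lia.
by move: hc; rewrite /critical /on_layer /in_box; lia.
Qed.

(** [v] and [v'] differ by at most 2M, distinct multiples of 2M + 1 by more. *)
Lemma large_multiple_separates (M u u' v v' : int) :
  `|v| <= M -> `|v'| <= M -> u != u' ->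
  v + (2 * M + 1) * u != v' + (2 * M + 1) * u'.
Proof.
move=> hv hv' uu; apply/eqP => E.
have {}E : (2 * M + 1) * (u - u') = v' - v.
  by rewrite mulrBr; move: E; move: (_ * u) (_ * u'); lia.
have : `|(2 * M + 1) * (u - u')| <= 2 * M by rewrite E; lia.
by rewrite normrM; nia.
Qed.

Lemma good_step (f g : int -> int -> int) (a b c d p : int) :
  good f a b c d -> a <= b -> c <= 2 * p - b - 2 <= d ->
  (forall x y, in_box a b c d x y -> f x y != f p (b + 2 - p)) ->
  (forall x y, x + y <= 0 -> g x y = 0) ->
  (forall x y, x + y = 1 -> g x y = parity_sign x) ->
  (forall x y, x + y = 2 -> g x y = parity_sign x * (- 4 * x)) ->
  (forall x y, x + y = 3 -> g x y = parity_sign x * (8 * x * (x - 1))) ->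
  exists B : int,
    good (fun x y => f x y + B * g (x - p) (y - (b - p))) a (b + 2) c d.
Proof.
move=> gf hab hp hfresh g0 g1 g2 g3.
pose h x y := g (x - p) (y - (b - p)).
(* With [B] large, [f] only has to separate the pairs on which the shifted g agrees. *)
have sep x y x' y' : critical a (b + 2) c d x y x' y' ->
    (x != x') || (y != y') -> h x y = h x' y' -> f x y != f x' y'.
  move=> hc hne hh.
  have hval u v : u + v <= b + 2 ->
      [\/ u + v <= b /\ h u v = 0,
          u + v = b + 1 /\ (if (2 %| u - p)%Z then h u v = 1 else h u v = -1)
        | u + v = b + 2 /\
            (if (2 %| u - p)%Z then h u v = - 4 * (u - p) else h u v = 4 * (u - p))].
    move=> huv; have [h0|[h1|h2]] : u + v <= b \/ u + v = b + 1 \/ u + v = b + 2 by lia.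
    - by constructor 1; rewrite /h g0; lia.
    - by constructor 2; split=> //; rewrite /h g1 /parity_sign; [case: (2 %| _)%Z|lia].
    - constructor 3; split=> //; rewrite /h g2; last by lia.
      by case: (parity_signP (u - p)) => -[hp' ->]; [rewrite hp'|rewrite (negbTE hp')]; lia.
  (* g separates all new critical pairs, except when its zero on layer b + 2 is
     compared with a point of the old rectangle. *)
  have [hcf|hcf] := boolP (critical a b c d x y x' y'); first exact: gf.
  (* 8x(x - 1) agrees at distinct arguments only if their sum is 1, and then their parities
     differ. *)
  have [hb3|hb3] := eqVneq (x + y) (b + 3).
    have hx : (2 %| x - x')%Z /\ x' + y' = b + 3.
      by move: hc; rewrite /critical /on_layer /in_box; lia.
    have hxx : x != x' by lia.
    have hs : parity_sign (x - p) = parity_sign (x' - p).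
      by case: (parity_signP (x - p)) (parity_signP (x' - p)); lia.
    have := hh; rewrite /h g3 ?g3; [|lia|lia]; rewrite -hs.
    have s0 : parity_sign (x - p) != 0 by case: (parity_signP (x - p)); lia.
    move=> /(mulfI s0) E.
    have : (x - x') * (x + x' - 2 * p - 1) == 0 by lia.
    by rewrite mulf_eq0; lia.
  suff [[-> [-> hb]]|[-> [-> hb]]] :
      x = p /\ y = b + 2 - p /\ in_box a b c d x' y' \/
      x' = p /\ y' = b + 2 - p /\ in_box a b c d x y.
  - by rewrite eq_sym; apply: hfresh.
  - by apply: hfresh.
  have [hb2 hb2'] : x + y <= b + 2 /\ x' + y' <= b + 2.
    by move: hc; rewrite /critical /on_layer /in_box; lia.
  have hnew : b < x + y \/ b < x' + y'.
    have [?|?] := ltP b (x + y); first by left.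
    have [?|?] := ltP b (x' + y'); first by right.
    by case/negP: hcf; move: hc; rewrite /critical /on_layer /in_box; lia.
  (* The values 1 and -1 on layer b + 1 separate opposite parities; pairs of equal parity were
     critical for the old box already. *)
  have hsame : ~~ [&& (2 %| x - x')%Z, x + y == x' + y' & x + y == b + 1].
    apply/negP => hs; case/negP: hcf; move: hc hs.
    by rewrite /critical /on_layer /in_box; lia.
  have {}hc : in_box a (b + 2) c d x y /\ in_box a (b + 2) c d x' y' \/
      (2 %| x - x')%Z /\ x - y = x' - y' /\ (x - y < c \/ d < x - y).
    case/orP: hc => [/andP|/andP[h2 /orP[]]]; first by left.
    - by move=> /and4P[]; lia.
    - by move=> /and4P[]; right; split=> //; lia.
  case: hc => [[hc hc']|[hpar [hxy hxy']]].
  - move: hc hc' hh hsame (hval x y hb2) (hval x' y' hb2'); rewrite /in_box.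
    move: (h x y) (h x' y') => u u' hc hc' hh hsame {hval hcf hb3}.
    case=> -[H1]; try (case: ifP => H2); move=> H3;
      case=> -[H1']; try (case: ifP => H2'); move=> H3'; lia.
  (* Here the values of x + y differ by a multiple of 4, so at most one point is on a new layer. *)
  - have hold : x + y <= b \/ x' + y' <= b by lia.
    move: hh (hval x y hb2) (hval x' y' hb2').
    move: (h x y) (h x' y') => u u' hh {hval hcf hb3 hsame}.
    case=> -[H1]; try (case: ifP => H2); move=> H3;
      case=> -[H1']; try (case: ifP => H2'); move=> H3'; lia.
pose N := (`|a| + `|b| + `|c| + `|d| + 10)%N.
have [M hM] := bounded_on_square f N.
exists (2 * M + 1) => x y x' y' hc hne; rewrite -/(h x y) -/(h x' y').
have [bx by_ bx' by'] : [/\ `|x| <= N%:Z, `|y| <= N%:Z, `|x'| <= N%:Z & `|y'| <= N%:Z].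
  by move: hc; rewrite /critical /on_layer /in_box /N; split; lia.
have := hM x y bx by_; have := hM x' y' bx' by'.
have := sep x y x' y' hc hne.
move=> hsep hM' hM0; have [uu|uu] := eqVneq (h x y) (h x' y').
  by rewrite uu (inj_eq (addIr _)); apply: hsep.
exact: large_multiple_separates.
Qed.

Lemma step (f : int -> int -> int) (a b c d p t : int) :
  harmonic f -> good f a b c d -> a <= b -> c <= 2 * p - b - 2 <= d ->
  exists f' : int -> int -> int,
    [/\ harmonic f', good f' a (b + 2) c d,
        forall x y, in_box a b c d x y -> f' x y = f x y
      & exists x y, in_box a (b + 2) c d x y /\ f' x y = t].
Proof.
move=> hf gf hab hp.
pose N := (`|a| + `|b| + `|c| + `|d| + 10)%N.
have [M hM] := bounded_on_square f N.
(* If [t] is already attained in the box, any fresh value serves, such as [M + 1]. *)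
have [t' ht' htt'] : exists2 t' : int, forall x y, in_box a b c d x y -> f x y != t' &
    t' = t \/ exists x y, in_box a b c d x y /\ f x y = t.
  have [h|h] := classic (exists x y, in_box a b c d x y /\ f x y = t).
    exists (M + 1); last by right.
    move=> x y; rewrite /in_box => hb; suff : `|f x y| <= M by lia.
    by apply: hM; rewrite /N; lia.
  by exists t; [move=> x y hb; apply/eqP => E; apply: h; exists x, y|left].
have [g [hg g0 g1 g2 g3]] := half_plane_harmonic.
(* This shift of g vanishes up to layer b + 1, which keeps [f] good, and is 1 at the chosen point of
   layer b + 2. *)
pose f1 x y := f x y + (t' - f p (b + 2 - p)) * g (x - p) (y - (b + 1 - p)).
have f1E x y : x + y <= b + 1 -> f1 x y = f x y.
  by move=> hxy; rewrite /f1 g0 ?mulr0 ?addr0 //; lia.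
have f1t : f1 p (b + 2 - p) = t'.
  by rewrite /f1 g1 ?subrr; [rewrite mulr1; ring|ring].
have gf1 : good f1 a b c d.
  move=> x y x' y' hc hne; rewrite !f1E; first exact: gf.
  - by move: hc; rewrite /critical /on_layer /in_box; lia.
  - by move: hc; rewrite /critical /on_layer /in_box; lia.
have f1fresh x y : in_box a b c d x y -> f1 x y != f1 p (b + 2 - p).
  move=> hb; rewrite f1t f1E; first exact: ht'.
  by move: hb; rewrite /in_box; lia.
have [B hB] := good_step gf1 hab hp f1fresh g0 g1 g2 g3.
have f2E x y : in_box a b c d x y -> f1 x y + B * g (x - p) (y - (b - p)) = f x y.
  by rewrite /in_box => hb; rewrite f1E ?g0; [rewrite mulr0 addr0|lia|lia].
exists (fun x y => f1 x y + B * g (x - p) (y - (b - p))); split=> //.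
  exact/harmonic_comb/hg/harmonic_comb.
case: htt' => [<-|[x [y [hb <-]]]].
  exists p, (b + 2 - p); split; first by rewrite /in_box; lia.
  rewrite f1t g2; last by ring.
  by rewrite subrr; ring.
by exists x, y; rewrite f2E //; move: hb; rewrite /in_box; lia.
Qed.

(** The quarter turn brings the next side to the place where [step] acts; four turns restore the
    orientation. *)
Lemma step_rot (f : int -> int -> int) (a b c d p t : int) :
  harmonic f -> good f a b c d -> a <= b -> c <= 2 * p - b - 2 <= d ->
  exists f' : int -> int -> int,
    [/\ harmonic f', good f' c d (- (b + 2)) (- a),
        forall x y, in_box a b c d x y -> f' (- y) x = f x y
      & exists x y, in_box a (b + 2) c d x y /\ f' (- y) x = t].
Proof.
move=> hf gf hab hp; have [f' [hf' gf' ff' [x [y [hb ft]]]]] := step t hf gf hab hp.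
exists (fun x y => f' y (- x)); split.
- exact: harmonic_rot.
- exact: good_rot.
- by move=> x' y' hb'; rewrite opprK ff'.
- by exists x, y; rewrite opprK.
Qed.

(** * Exhaustion of the grid by diamonds *)

Definition diamond (n : nat) (x y : int) : bool := `|x| + `|y| <= n%:Z + n%:Z.

(** [diamond n] is the box [-2n, 2n] x [-2n, 2n] in the coordinates x + y, x - y. *)
Definition diamond_good (n : nat) (f : int -> int -> int) : Prop :=
  harmonic f /\ good f (- (n%:Z + n%:Z)) (n%:Z + n%:Z) (- (n%:Z + n%:Z)) (n%:Z + n%:Z).

Definition diamond_ext (n : nat) (t : int) (f f' : int -> int -> int) : Prop :=
  [/\ diamond_good n.+1 f', forall x y, diamond n x y -> f' x y = f x y
    & exists x y, diamond n.+1 x y /\ f' x y = t].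

Lemma diamond_step (n : nat) (t : int) (f : int -> int -> int) :
  diamond_good n f -> exists f', diamond_ext n t f f'.
Proof.
case=> hf; set m := n%:Z + n%:Z => gf.
have m2 : n.+1%:Z + n.+1%:Z = m + 2 by rewrite /m; lia.
(* Each time [b] is [m], so [p = n + 1] picks the point (n + 1, n + 1), where x - y = 0. Only the
   first turn attains [t]; the target 0 of the others is a dummy. *)
have [||f1 [hf1 gf1 e1 [x [y [hb E]]]]] := @step_rot f _ _ _ _ n.+1%:Z t hf gf; try lia.
have [||f2 [hf2 gf2 e2 _]] := @step_rot f1 _ _ _ _ n.+1%:Z 0 hf1 gf1; try lia.
have [||f3 [hf3 gf3 e3 _]] := @step_rot f2 _ _ _ _ n.+1%:Z 0 hf2 gf2; try lia.
have [||f4 [hf4 gf4 e4 _]] := @step_rot f3 _ _ _ _ n.+1%:Z 0 hf3 gf3; try lia.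
have e u v : in_box (- m) (m + 2) (- m) m u v -> f4 u v = f1 (- v) u.
  rewrite /in_box => huv.
  rewrite -[u in f4 u]opprK e4; last by rewrite /in_box; lia.
  rewrite -[v in f3 v]opprK e3; last by rewrite /in_box; lia.
  by rewrite e2 //; rewrite /in_box; lia.
exists f4; split.
- by split=> //; rewrite m2; move: gf4; rewrite !opprK.
- move=> u v; rewrite /diamond -/m => huv; rewrite e ?e1 //; rewrite /in_box; lia.
- exists x, y; rewrite e //; split=> //.
  by move: hb; rewrite /diamond m2 /in_box; lia.
Qed.

Lemma diamond_sequence (t : nat -> int) : exists F : nat -> int -> int -> int,
  forall n, diamond_good n (F n) /\ diamond_ext n (t n) (F n) (F n.+1).
Proof.
pose inh := inhabits (fun _ _ : int => 0 : int).
pose F := nat_rect (fun _ => int -> int -> int) (fun _ _ => 0)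
  (fun n f => epsilon inh (diamond_ext n (t n) f)).
have FS n : diamond_good n (F n) -> diamond_ext n (t n) (F n) (F n.+1).
  by move=> /(diamond_step (t n)); apply: epsilon_spec.
exists F => n; suff gF : diamond_good n (F n) by split=> //; apply: FS.
elim: n => [|n IHn]; last by case: (FS n IHn).
(* The initial box is the origin alone, and by parity its outer layers contain no grid point. *)
split=> [x y|x y x' y']; first by rewrite /F /=; ring.
by rewrite /critical /on_layer /in_box; lia.
Qed.

Lemma harmonic_bijection : exists f : int -> int -> int,
  harmonic f /\ bijective (fun P : int * int => f P.1 P.2).
Proof.
(* Each integer z is the target at index [pickle z]; the default 0 fills the other indices. *)
have [F hF] := diamond_sequence (fun n => odflt 0 (unpickle n)).
have stable n k x y : diamond n x y -> F (k + n)%N x y = F n x y.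
  move=> hd; elim: k => // k <-; rewrite addSn.
  by case: (hF (k + n)%N) => _ [_ -> //]; move: hd; rewrite /diamond; lia.
pose f x y := F (`|x| + `|y|)%N x y.
have fE n x y : (`|x| + `|y| <= n)%N -> f x y = F n x y.
  by move=> hn; rewrite -(subnK hn) (stable (`|x| + `|y|)%N) // /diamond; lia.
exists f; split.
  move=> x y; pose n := (`|x| + `|y|).+1.
  rewrite !(fE n) /n; try lia.
  by case: (hF n) => -[+ _] _; apply.
have inj : injective (fun P : int * int => f P.1 P.2).
  move=> [x y] [x' y'] /= E; pose n := (`|x| + `|y| + (`|x'| + `|y'|))%N.
  case: (hF n) => -[_ /(_ x y x' y') g] _.
  apply/eqP; rewrite xpair_eqE -[_ && _]negbK negb_and; apply/negP => hne.
  have : F n x y != F n x' y'.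
    by apply: g => //; rewrite /critical /in_box /n; lia.
  by rewrite -!fE ?E ?eqxx // /n; lia.
have surj z : exists P : int * int, f P.1 P.2 == z.
  case: (hF (pickle z)) => _ [_ _ [x [y [hd]]]]; rewrite pickleK /= => E.
  exists (x, y); apply/eqP; rewrite -E /=.
  rewrite (fE (`|x| + `|y| + (pickle z).+1)%N) ?leq_addr //.
  exact: stable.
exists (fun z => xchoose (surj z)) => [P|z].
  by apply: inj; apply/eqP/(xchooseP (surj _)).
exact/eqP/(xchooseP (surj z)).
Qed.

Theorem theorem4 :
  exists phi : int * int -> int,
    harmonic_labeling square_grid phi /\
    forall x y : int,
      (phi (x, y))%:~R =
        4%:R^-1 * ((phi (x + 1, y))%:~R + (phi (x - 1, y))%:~R
                   + (phi (x, y + 1))%:~R + (phi (x, y - 1))%:~R) :> rat.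
Proof.
have [f [hf bf]] := harmonic_bijection.
have mean x y : (f x y)%:~R = 4%:R^-1 * ((f (x + 1) y)%:~R + (f (x - 1) y)%:~R
    + (f x (y + 1))%:~R + (f x (y - 1))%:~R) :> rat.
  by rewrite -!intrD -hf intrM mulrA mulVf // mul1r.
exists (fun P => f P.1 P.2); split=> [|x y]; last exact: mean.
split=> // -[x y].
by rewrite /deg /= !big_cons big_nil /= addr0 !addrA mean.
Qed.
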